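(* Let $G=(V,F,(\partial a)_{a\in F},(\psi_a)_{a\in F})$ be a $\Psi$-factor graph whose Gibbs distribution $\mu=\mu_G$ is symmetric, let $\Lambda\subseteq V$, and let $\eta,\kappa\in\mathcal{A}^\Lambda$ differ on exactly one variable node of $\Lambda$. For $\theta,\xi\in\mathcal{A}^V$ let $P_{\eta,\kappa}(\theta,\xi)=\Pr[\mathtt{Switch}(G,\theta,\eta,\kappa)\text{ outputs }\xi]$. Then for all $\theta,\xi\in\mathcal{A}^V$, $$\mu(\theta)P_{\eta,\kappa}(\theta,\xi)=\mu(\xi)P_{\kappa,\eta}(\xi,\theta).$$
   Context: A $\Psi$-factor graph: variable nodes $V$, factor nodes $F$, for each $a\in F$ an ordered $k$-tuple $\partial a\in V^k$ and a weight function $\psi_a:\mathcal{A}^k\to[0,2)$ from $\Psi$; Gibbs distribution $\mu(\sigma)\propto\prod_{a\in F}\psi_a(\sigma(\partial_1a),\dots,\sigma(\partial_ka))$ on $\mathcal{A}^V$. Symmetry means: for every two-element $\mathcal{D}\subseteq\mathcal{A}$ and $\sigma,\tau\in\mathcal{A}^k$ with $\tau(i)=\sigma(i)$ when $\sigma(i)\notin\mathcal{D}$ and $\tau(i)$ equal to the other element of $\mathcal{D}$ otherwise, $\psi(\tau)=\psi(\sigma)$ for all weight functions (and, with $q=|\mathcal{A}|$, $\sum_{\tau}\mathbf{1}\{\tau_i=c\}\psi(\tau)$ is the same constant for all $i,c,\psi$). For a factor node $\beta$, $\mathfrak{m}_\beta$ is the distribution on $\mathcal{A}^{\partial\beta}$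 with $\mathfrak{m}_\beta(\eta)\propto\psi_\beta(\eta)$. Process $\mathtt{Switch}(G,\sigma,\eta,\kappa)$, for $\sigma\in\mathcal{A}^V$ with $\sigma(\Lambda)=\eta$, where $\eta,\kappa$ differ exactly at $x\in\Lambda$. Let $\mathcal{D}=\{\eta(x),\kappa(x)\}$. Set $\tau(\Lambda)=\kappa$, $\mathcal{N}=\Lambda$, $\mathcal{Q}=\{x\}$. While there is a factor node $\beta\notin\mathcal{N}$ with $\partial\beta\cap\mathcal{Q}\ne\emptyset$, pick such $\beta$ by a fixed deterministic rule depending only on the current sets $\mathcal{N},\mathcal{Q}$; if $|\partial\beta\cap\mathcal{N}|>1$, output Fail and stop. Otherwise let $\partial_1\beta$ denote the unique variable node of $\partial\beta$ in $\mathcal{N}$ (relabelling coordinates), let $\hat\sigma\in\mathcal{A}^{\partial\beta}$ agree with $\tau$ at $\partial_1\beta$ and with $\sigma$ elsewhere, and let $q_\beta=\max\{0,1-\mathfrak{m}_\beta(\hat\sigma(\partial\beta)\mid\partial_1\beta,\tau)/\mathfrak{m}_\beta(\sigma(\partial\beta)\mid\partial_1\beta,\sigma)\}$ (conditional probabilities given the spin at $\partial_1\beta$). With probability $1-q_\beta$ set $\tau(\partial_r\beta)=\sigma(\partial_r\beta)$ for $r=2,\dots,k$; with probability $q_\beta$ set, for $r=2,\dots,k$, $\tau(\partial_r\beta)$ equal to the other element of $\mathcal{D}$ if $\sigma(\partial_r\beta)\in\mathcal{D}$ and $\tau(\partial_r\beta)=\sigma(\partial_r\beta)$ otherwise. Add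 $\beta$ and $\partial\beta$ to $\mathcal{N}$ and add to $\mathcal{Q}$ the nodes $z\in\partial\beta$ with $\tau(z)\ne\sigma(z)$. When the loop ends, set $\tau(z)=\sigma(z)$ for every $z$ with $\tau(z)$ unspecified, and output $\tau$. *)

(* Defs.v *)
From HB Require Import structures.
From mathcomp Require Import all_boot all_order all_algebra all_fingroup.

Set Implicit Arguments.
Unset Strict Implicit.
Unset Printing Implicit Defensive.

Import Order.TTheory GRing.Theory Num.Theory.
Local Open Scope ring_scope.

Definition weight (R : realFieldType) (A : finType) (k : nat) :=
  k.-tuple A -> R.

(* [tperm c d] exchanges the two elements of {c, d} and fixes every other
   spin. *)
Definition symmetric_family (R : realFieldType) (A : finType) (k : nat)
    (Psi : weight R A k -> Prop) : Prop :=
  (forall c d : A, c != d ->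
     forall psi, Psi psi ->
     forall s : k.-tuple A, psi (map_tuple (tperm c d) s) = psi s) /\
  (exists C : R, forall psi, Psi psi ->
     forall (i : 'I_k) (c : A),
     \sum_(t : k.-tuple A | tnth t i == c) psi t = C).

(* The entries of the tuple [bd G a] may repeat, as in V^k; the set of variable
   nodes adjacent to a is {v | v \in bd G a}. *)
Record factor_graph (R : realFieldType) (A V F : finType) (k : nat)
    (Psi : weight R A k -> Prop) := FactorGraph {
  bd : F -> k.-tuple V;
  wt : F -> weight R A k;
  wt_in : forall a, Psi (wt a)
}.

Definition gibbs_weight (R : realFieldType) (A V F : finType) (k : nat)
    (Psi : weight R A k -> Prop) (G : factor_graph V F Psi)
    (sigma : {ffun V -> A}) : R :=
  \prod_(a : F) wt G a (map_tuple sigma (bd G a)).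

(* If all Gibbs weights vanish, no Gibbs distribution exists and this is the
   zero function. *)
Definition gibbs (R : realFieldType) (A V F : finType) (k : nat)
    (Psi : weight R A k -> Prop) (G : factor_graph V F Psi)
    (sigma : {ffun V -> A}) : R :=
  gibbs_weight G sigma / \sum_(tau : {ffun V -> A}) gibbs_weight G tau.

Notation nbr G b := {v | v \in bd G b}.

Definition local_weight (R : realFieldType) (A V F : finType) (k : nat)
    (Psi : weight R A k -> Prop) (G : factor_graph V F Psi) (b : F)
    (zeta : {ffun nbr G b -> A}) : R :=
  wt G b [tuple zeta (exist _ (tnth (bd G b) i) (mem_tnth i (bd G b))) | i < k].

Definition local_gibbs (R : realFieldType) (A V F : finType) (k : nat)
    (Psi : weight R A k -> Prop) (G : factor_graph V F Psi) (b : F)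
    (zeta : {ffun nbr G b -> A}) : R :=
  local_weight zeta / \sum_(zeta' : {ffun nbr G b -> A}) local_weight zeta'.

(* Conditional probability of [zeta] given that the spin at [y] is [c]. *)
Definition local_cond (R : realFieldType) (A V F : finType) (k : nat)
    (Psi : weight R A k -> Prop) (G : factor_graph V F Psi) (b : F)
    (y : nbr G b) (c : A) (zeta : {ffun nbr G b -> A}) : R :=
  (if zeta y == c then local_gibbs zeta else 0) /
  \sum_(zeta' : {ffun nbr G b -> A} | zeta' y == c) local_gibbs zeta'.

(* [c] is the spin of tau at [y]. The value for a vanishing denominator is
   immaterial, as then the Gibbs weight of [sigma] is 0. *)
Definition flip_prob (R : realFieldType) (A V F : finType) (k : nat)
    (Psi : weight R A k -> Prop) (G : factor_graph V F Psi)
    (sigma : {ffun V -> A}) (b : F) (y : nbr G b) (c : A) : R :=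
  let sigma_b : {ffun nbr G b -> A} := [ffun w => sigma (val w)] in
  let hat_b : {ffun nbr G b -> A} :=
    [ffun w => if w == y then c else sigma (val w)] in
  Num.max 0 (1 - local_cond y c hat_b / local_cond y (sigma (val y)) sigma_b).

(* In N : {set V + F}, [inl] marks variable nodes and [inr] factor nodes. *)
Definition eligible (R : realFieldType) (A V F : finType) (k : nat)
    (Psi : weight R A k -> Prop) (G : factor_graph V F Psi)
    (N : {set V + F}) (Q : {set V}) (b : F) : bool :=
  (inr b \notin N) && [exists v in Q, v \in bd G b].

Definition selection_rule (V F : finType) :=
  {set V + F} -> {set V} -> option F.

Definition valid_rule (R : realFieldType) (A V F : finType) (k : nat)
    (Psi : weight R A k -> Prop) (G : factor_graph V F Psi)
    (rule : selection_rule V F) : Prop :=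
  forall N Q,
    match rule N Q with
    | Some b => is_true (eligible G N Q b)
    | None => forall b, ~~ eligible G N Q b
    end.

Definition complete (A V : finType) (sigma : {ffun V -> A})
    (tau : {ffun V -> option A}) : {ffun V -> A} :=
  [ffun v => odflt (sigma v) (tau v)].

(* Law of the output of the loop started at (N, Q, tau), where D = {c, d},
   [tau v = None] means that tau(v) is unspecified, and the output [None] is
   Fail. Every round adds a new factor node to N, so fuel [n] suffices as soon
   as at most n factor nodes are outside N. The last branch of the inner match
   is never reached from the initial state of Switch with fuel #|F|: Q stays
   inside N, so that a selected factor node always has a neighbour in N. *)
Fixpoint switch_loop (R : realFieldType) (A V F : finType) (k : nat)
    (Psi : weight R A k -> Prop) (G : factor_graph V F Psi)
    (rule : selection_rule V F) (c d : A) (sigma : {ffun V -> A})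
    (n : nat) (N : {set V + F}) (Q : {set V}) (tau : {ffun V -> option A})
    (out : option {ffun V -> A}) {struct n} : R :=
  match rule N Q with
  | None => (out == Some (complete sigma tau))%:R
  | Some b =>
      if (1 < #|[set v in bd G b | inl v \in N]|)%N then (out == None)%:R
      else
        match n, [pick y : nbr G b | inl (val y) \in N] with
        | n'.+1, Some y =>
            let q := flip_prob sigma y (complete sigma tau (val y)) in
            let update (f : A -> A) : {ffun V -> option A} :=
              [ffun v => if (v \in bd G b) && (v != val y)
                         then Some (f (sigma v)) else tau v] in
            let continue (tau' : {ffun V -> option A}) : R :=
              switch_loop G rule c d sigma n'
                (inr b |: (N :|: [set inl v | v in bd G b]))
                (Q :|: [set z in bd G b | tau' z != Some (sigma z)])
                tau' out in
            (1 - q) * continue (update id) + q * continue (update (tperm c d))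
        | _, _ => (out == None)%:R
        end
  end.

(* Law of Switch(G, sigma, eta, kappa); [x] is the node of Lam where eta and
   kappa differ. *)
Definition switch (R : realFieldType) (A V F : finType) (k : nat)
    (Psi : weight R A k -> Prop) (G : factor_graph V F Psi)
    (rule : selection_rule V F) (Lam : {set V})
    (eta kappa : {ffun {v : V | v \in Lam} -> A})
    (sigma : {ffun V -> A}) (out : option {ffun V -> A}) : R :=
  match [pick x | eta x != kappa x] with
  | Some x =>
      switch_loop G rule (eta x) (kappa x) sigma #|F|
        [set inl v | v in Lam] [set val x]
        [ffun v => omap kappa (insub v)] out
  | None => 0
  end.

(* P_{eta,kappa}(theta, xi). Switch(G, theta, eta, kappa) is only defined when
   theta(Lam) = eta; otherwise it outputs nothing. *)
Definition switch_prob (R : realFieldType) (A V F : finType) (k : nat)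
    (Psi : weight R A k -> Prop) (G : factor_graph V F Psi)
    (rule : selection_rule V F) (Lam : {set V})
    (eta kappa : {ffun {v : V | v \in Lam} -> A})
    (theta xi : {ffun V -> A}) : R :=
  if [forall w : {v : V | v \in Lam}, theta (val w) == eta w]
  then switch G rule eta kappa theta (Some xi) else 0.

(* Main.v *)
Require Import Defs.
From HB Require Import structures.
From mathcomp Require Import all_boot all_order all_algebra all_fingroup.

Set Implicit Arguments.
Unset Strict Implicit.
Unset Printing Implicit Defensive.

Import Order.TTheory GRing.Theory Num.Theory.
Local Open Scope ring_scope.

(** Run Switch from [theta] towards [xi] and, in parallel, from [xi] towards
    [theta]. As long as both runs can still reach their targets they share the
    same sets N and Q, and Q is the set of nodes of N where [theta] and [xi]
    disagree. Hence detailed balance reduces to one factor node b: with weights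
    w at [theta] and w' at the configuration that changes only the spin at
    the explored node, keeping contributes w (1 - q) = min(w, w'), which is
    symmetric, while flipping leaves both w and w', hence q, invariant. The
    factor nodes never explored see the same spins in [theta] and [xi]. *)

Section Switch.

Variables (R : realFieldType) (A V F : finType) (k : nat).
Variables (Psi : weight R A k -> Prop) (G : factor_graph V F Psi).

(** * Partial configurations and explored sets *)

Definition factor_weight (b : F) (sigma : {ffun V -> A}) : R :=
  wt G b (map_tuple sigma (bd G b)).

(** The value of [tau] in a run that has explored [N] and still agrees with its target [sigma]. *)
Definition restrict (N : {set V + F}) (sigma : {ffun V -> A}) :
    {ffun V -> option A} :=
  [ffun v => if inl v \in N then Some (sigma v) else None].

(** The change of [tau] in a round at [b]: [f] is the identity for keeping and the swap of the two
    spins for flipping. *)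
Definition move_step (f : A -> A) (b : F) (y : V) (sigma : {ffun V -> A})
    (tau : {ffun V -> option A}) : {ffun V -> option A} :=
  [ffun v => if (v \in bd G b) && (v != y) then Some (f (sigma v)) else tau v].

Definition explore (b : F) (N : {set V + F}) : {set V + F} :=
  inr b |: (N :|: [set inl v | v in bd G b]).

Lemma inl_explore b N v :
  (inl v \in explore b N) = (inl v \in N) || (v \in bd G b).
Proof.
rewrite !inE /=; congr (_ || _).
by apply/imsetP/idP => [[w wb [->]] //|vb]; exists v.
Qed.

Lemma inr_explore b N a : (inr a \in explore b N) = (a == b) || (inr a \in N).
Proof.
rewrite !inE /=; congr (_ || _).
suff -> : (inr a \in [set inl v | v in bd G b]) = false by rewrite orbF.
by apply/negbTE/imsetP => -[].
Qed.

Lemma complete_restrict N (sigma tau : {ffun V -> A}) v :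
  complete sigma (restrict N tau) v = if inl v \in N then tau v else sigma v.
Proof. by rewrite !ffunE; case: ifP. Qed.

Lemma eq_factor_weight b (sigma tau : {ffun V -> A}) :
  {in bd G b, sigma =1 tau} -> factor_weight b sigma = factor_weight b tau.
Proof.
move=> e; congr (wt G b _); apply: eq_from_tnth => i.
by rewrite !tnth_map e // mem_tnth.
Qed.

Lemma local_weight_restr b (sigma : {ffun V -> A}) :
  local_weight ([ffun w => sigma (val w)] : {ffun nbr G b -> A}) =
  factor_weight b sigma.
Proof.
congr (wt G b _); apply: eq_from_tnth => i.
by rewrite tnth_mktuple tnth_map ffunE.
Qed.

Lemma unique_explored b (N : {set V + F}) y v :
  (#|[set v in bd G b | inl v \in N]| <= 1)%N ->
  y \in bd G b -> inl y \in N -> v \in bd G b -> inl v \in N -> v = y.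
Proof.
move=> /card_le1_eqP le1 yb yN vb vN.
by apply: le1; rewrite inE ?yb ?yN ?vb ?vN.
Qed.

(** * Persistence of specified spins *)

(** A wrong spin is permanent: a round writes only on nodes of its factor node other than the
    explored one, and none of these is in [N] when the failure test passes. The [odflt] condition
    says that [tau v] is specified and wrong. *)
Lemma switch_loop_eq0 rule c d sigma n (N : {set V + F}) Q
    (tau : {ffun V -> option A}) (out : {ffun V -> A}) v :
  inl v \in N -> odflt (out v) (tau v) != out v ->
  switch_loop G rule c d sigma n N Q tau (Some out) = 0.
Proof.
elim: n N Q tau => [|n IHn] N Q tau vN neq /=; case: (rule N Q) => [b|].
- by case: ifP.
- case: eqP => // -[/ffunP/(_ v)]; rewrite ffunE => e.
  by move: neq; rewrite e; case: (tau v) => [a|] /=; rewrite eqxx.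
- case: ltnP => // le1; case: pickP => // y yN.
  have keep f : odflt (out v) (move_step f b (val y) sigma tau v) != out v.
    rewrite ffunE; case: ifP => // /andP[vb].
    by rewrite (unique_explored le1 (valP y) yN vb vN) eqxx.
  have vN' : inl v \in explore b N by rewrite inl_explore vN.
  rewrite (IHn _ _ _ vN' (keep id)) (IHn _ _ _ vN' (keep (tperm c d))).
  by rewrite !mulr0 addr0.
- case: eqP => // -[/ffunP/(_ v)]; rewrite ffunE => e.
  by move: neq; rewrite e; case: (tau v) => [a|] /=; rewrite eqxx.
Qed.

(** * Disagreement sets and single rounds *)

Definition disagreement (N : {set V + F}) (sigma tau : {ffun V -> A}) :
    {set V} :=
  [set v | (inl v \in N) && (sigma v != tau v)].

Lemma in_disagreement N sigma tau v :
  (v \in disagreement N sigma tau) = (inl v \in N) && (sigma v != tau v).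
Proof. exact: in_set. Qed.

Lemma disagreementC N sigma tau :
  disagreement N sigma tau = disagreement N tau sigma.
Proof. by apply/setP => v; rewrite !inE eq_sym. Qed.

(** The move that a round at [b] must make for a run from [sigma] to remain able to reach [tau]. *)
Definition follows (f : A -> A) (b : F) (y : V) (sigma tau : {ffun V -> A}) :=
  [forall v in bd G b, (v != y) ==> (tau v == f (sigma v))].

Lemma followsP f b y (sigma tau : {ffun V -> A}) :
  reflect {in bd G b, forall v, v != y -> tau v = f (sigma v)}
    (follows f b y sigma tau).
Proof.
apply: (iffP forall_inP) => H v vb; last by apply/implyP => /(H v vb) ->.
by move/implyP: (H v vb) => {}H /H/eqP.
Qed.

Lemma followsC f b y sigma tau :
  involutive f -> follows f b y sigma tau = follows f b y tau sigma.
Proof. by move=> fK; apply/followsP/followsP => H v vb /(H v vb) ->. Qed.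

(** A round either leads to a state of the same form on the larger explored set, or writes a spin
    that misses the target for good. *)
Lemma switch_loop_branch rule c d (theta xi : {ffun V -> A}) n
    (N : {set V + F}) b y f :
  (#|[set v in bd G b | inl v \in N]| <= 1)%N -> y \in bd G b -> inl y \in N ->
  switch_loop G rule c d theta n (explore b N)
    (disagreement N theta xi :|: [set z in bd G b |
       move_step f b y theta (restrict N xi) z != Some (theta z)])
    (move_step f b y theta (restrict N xi)) (Some xi) =
  if follows f b y theta xi then
    switch_loop G rule c d theta n (explore b N)
      (disagreement (explore b N) theta xi) (restrict (explore b N) xi)
      (Some xi)
  else 0.
Proof.
move=> le1 yb yN; case: followsP => [fol|nfol].
  have -> : move_step f b y theta (restrict N xi) = restrict (explore b N) xi.
    apply/ffunP => v; rewrite !ffunE inl_explore.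
    have [vb|vb] /= := boolP (v \in bd G b); last by rewrite orbF.
    by rewrite orbT; case: eqVneq => [->|/(fol v vb) <- //]; rewrite yN.
  congr switch_loop; apply/setP => v; rewrite in_setU.
  rewrite !in_disagreement inl_explore in_set ffunE inl_explore.
  case: (inl v \in N); case: (v \in bd G b) => //=;
    by rewrite ?(inj_eq Some_inj) ?[xi v == _]eq_sym ?orbb ?orbF.
have [v /and3P[vb vy neq]] : exists v,
    [&& v \in bd G b, v != y & xi v != f (theta v)].
  apply/existsP; apply: contra_notT nfol => /existsPn H v vb vy.
  by move: (H v); rewrite vb vy /= negbK => /eqP.
apply: (@switch_loop_eq0 _ _ _ _ _ _ _ _ _ v).
  by rewrite inl_explore vb orbT.
by rewrite ffunE vb vy /= eq_sym.
Qed.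

(** * Symmetric weights and flip probabilities *)

Section Symmetry.

Hypothesis Psi_ge0 : forall psi, Psi psi -> forall s, 0 <= psi s.
Variables (c d : A).
Hypothesis Psi_tperm : forall psi, Psi psi ->
  forall s : k.-tuple A, psi (map_tuple (tperm c d) s) = psi s.

Lemma factor_weight_ge0 b sigma : 0 <= factor_weight b sigma.
Proof. exact: (Psi_ge0 (wt_in G b)). Qed.

Lemma local_weight_ge0 b (zeta : {ffun nbr G b -> A}) : 0 <= local_weight zeta.
Proof. exact: (Psi_ge0 (wt_in G b)). Qed.

Lemma factor_weight_tperm b (sigma tau : {ffun V -> A}) :
  {in bd G b, forall v, tau v = tperm c d (sigma v)} ->
  factor_weight b tau = factor_weight b sigma.
Proof.
move=> e; rewrite /factor_weight -[RHS](Psi_tperm (wt_in G b)).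
congr (wt G b _); apply: eq_from_tnth => i.
by rewrite !tnth_map e // mem_tnth.
Qed.

Lemma local_weight_tperm b (zeta : {ffun nbr G b -> A}) :
  local_weight ([ffun w => tperm c d (zeta w)] : {ffun nbr G b -> A}) =
  local_weight zeta.
Proof.
rewrite /local_weight -(Psi_tperm (wt_in G b)); congr (wt G b _).
by apply: eq_from_tnth => i; rewrite tnth_map !tnth_mktuple ffunE tpermK.
Qed.

(** The swap permutes the local configurations and preserves their weights. Hence the two
    conditional probabilities in [flip_prob] at a swapped spin have equal normalizations, and their
    ratio is a ratio of weights. *)
Lemma marginal_tperm b (y : nbr G b) (e : A) :
  \sum_(zeta : {ffun nbr G b -> A} | zeta y == tperm c d e) local_gibbs zeta =
  \sum_(zeta : {ffun nbr G b -> A} | zeta y == e) local_gibbs zeta.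
Proof.
pose h (z : {ffun nbr G b -> A}) : {ffun nbr G b -> A} :=
  [ffun w => tperm c d (z w)].
have hK : involutive h by move=> z; apply/ffunP => w; rewrite !ffunE tpermK.
rewrite (reindex_inj (inv_inj hK)); apply: eq_big => z.
  by rewrite ffunE (inj_eq perm_inj).
by rewrite /local_gibbs local_weight_tperm.
Qed.

(* The junk value x / 0 = 0 makes this hold even if [factor_weight b sigma]
   vanishes. *)
Lemma flip_probE b (y : nbr G b) (sigma tau : {ffun V -> A}) :
  tau (val y) = tperm c d (sigma (val y)) ->
  {in bd G b, forall v, v != val y -> tau v = sigma v} ->
  flip_prob sigma y (tau (val y)) =
  Num.max 0 (1 - factor_weight b tau / factor_weight b sigma).
Proof.
move=> tauy tauE; rewrite /flip_prob; congr (Num.max 0 (1 - _)).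
have -> : [ffun w => if w == y then tau (val y) else sigma (val w)] =
          [ffun w => tau (val w)] :> {ffun nbr G b -> A}.
  apply/ffunP => w; rewrite !ffunE; case: eqVneq => [->//|wy].
  by rewrite tauE ?val_eqE // (valP w).
rewrite /local_cond !ffunE !eqxx tauy marginal_tperm /local_gibbs.
rewrite !local_weight_restr.
set Z := \sum_z local_weight z.
set S := \sum_(z | _) _.
have [->|w0] := eqVneq (factor_weight b sigma) 0.
  by rewrite !mul0r invr0 !mulr0.
have w_gt0 : 0 < factor_weight b sigma by rewrite lt_def w0 factor_weight_ge0.
have Z_gt0 : 0 < Z.
  rewrite /Z (bigD1 [ffun w => sigma (val w)]) //= local_weight_restr.
  by rewrite ltr_wpDr // sumr_ge0 // => z _; exact: local_weight_ge0.
have S_gt0 : 0 < S.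
  rewrite /S (bigD1 [ffun w => sigma (val w)]) /= ?ffunE // local_weight_restr.
  rewrite ltr_wpDr ?divr_gt0 // sumr_ge0 // => z _.
  by rewrite divr_ge0 ?local_weight_ge0 // ltW.
rewrite -!(mulrA _ Z^-1) -mulf_div divff ?mulr1 //.
by rewrite mulf_neq0 ?invr_eq0 ?gt_eqF.
Qed.

Lemma flip_prob_keep b (y : nbr G b) (sigma tau : {ffun V -> A}) :
  tau (val y) = tperm c d (sigma (val y)) ->
  {in bd G b, forall v, v != val y -> tau v = sigma v} ->
  factor_weight b sigma * (1 - flip_prob sigma y (tau (val y))) =
  Num.min (factor_weight b sigma) (factor_weight b tau).
Proof.
move=> tauy tauE; rewrite flip_probE //.
have := factor_weight_ge0 b sigma; have := factor_weight_ge0 b tau.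
move: (factor_weight b sigma) (factor_weight b tau) => w w' w'0 w0.
have [->|wn0] := eqVneq w 0; first by rewrite mul0r min_l.
have w_gt0 : 0 < w by rewrite lt_def wn0.
have [le|lt] := lerP w w'.
  by rewrite max_l ?subr0 ?mulr1 // subr_le0 ler_pdivlMr // mul1r.
rewrite max_r; last by rewrite subr_ge0 ler_pdivrMr // mul1r ltW.
by rewrite subKr mulrCA divff // mulr1.
Qed.

(** The swap carries [sigma] with only its spin at [y] changed to [tau] with only its spin at [y]
    changed, so both weight ratios coincide. *)
Lemma flip_prob_flip b (y : nbr G b) (sigma tau : {ffun V -> A}) :
  {in bd G b, forall v, tau v = tperm c d (sigma v)} ->
  flip_prob tau y (sigma (val y)) = flip_prob sigma y (tau (val y)).
Proof.
move=> tauE.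
pose hat (s t : {ffun V -> A}) : {ffun V -> A} :=
  [ffun v => if v == val y then t v else s v].
have haty s (t : {ffun V -> A}) : t (val y) = hat s t (val y).
  by rewrite ffunE eqxx.
have hatN s t : {in bd G b, forall v, v != val y -> hat s t v = s v}.
  by move=> v _ /negbTE vy; rewrite ffunE vy.
have yE := tauE _ (valP y).
(* [flip_prob] sees the new configuration only through its spin at [y], so a hybrid equal to the old
   one elsewhere may replace it. *)
rewrite (haty tau sigma) (haty sigma tau) !flip_probE //; last 2 first.
- by rewrite -haty.
- by rewrite -haty yE tpermK.
rewrite (factor_weight_tperm tauE) (@factor_weight_tperm b (hat sigma tau)) //.
move=> v vb; rewrite !ffunE.
by case: eqP => [->|_]; rewrite ?tauE ?tpermK ?(valP y).
Qed.

(** * Detailed balance for the loop *)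

(** Induction on the fuel, peeling one factor weight off the product per round. The rule depends
    only on [N] and [Q], which both runs share, so it picks the same factor node for both. *)
Lemma switch_loop_balance rule (theta xi : {ffun V -> A}) n (N : {set V + F}) :
  valid_rule G rule ->
  {in disagreement N theta xi, forall v, xi v = tperm c d (theta v)} ->
  switch_loop G rule c d theta n N (disagreement N theta xi) (restrict N xi)
    (Some xi) * \prod_(a | inr a \notin N) factor_weight a theta =
  switch_loop G rule d c xi n N (disagreement N theta xi) (restrict N theta)
    (Some theta) * \prod_(a | inr a \notin N) factor_weight a xi.
Proof.
move=> rule_ok.
(* When the loop ends, either indicator says that the configurations agree outside [N']. Inside, an
   unexplored factor node at a disagreement would be eligible. *)
have stop N' : rule N' (disagreement N' theta xi) = None ->
    (Some xi == Some (complete theta (restrict N' xi)))%:R *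
      \prod_(a | inr a \notin N') factor_weight a theta =
    (Some theta == Some (complete xi (restrict N' theta)))%:R *
      \prod_(a | inr a \notin N') factor_weight a xi.
  move=> ruleN; move: (rule_ok N' (disagreement N' theta xi)).
  rewrite ruleN => stuck.
  have agreeP (s t : {ffun V -> A}) : reflect
      (forall v, inl v \notin N' -> s v = t v)
      (Some t == Some (complete s (restrict N' t))).
    apply: (iffP eqP) => [[/ffunP e] v vN|e].
      by rewrite (e v) complete_restrict (negbTE vN).
    congr Some; apply/ffunP => v; rewrite complete_restrict.
    by case: ifPn => // /e.
  have -> : (Some theta == Some (complete xi (restrict N' theta))) =
            (Some xi == Some (complete theta (restrict N' xi))).
    by apply/agreeP/agreeP => e v /e.
  case: agreeP => [agree|_]; last by rewrite !mul0r.
  congr (_ * _); apply: eq_bigr => a aN; apply: eq_factor_weight => v va.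
  have [vN|/agree//] := boolP (inl v \in N').
  apply/eqP; apply: contraNT (stuck a) => neq.
  by rewrite /eligible aN; apply/existsP; exists v; rewrite inE vN neq.
elim: n N => [|n IHn] N tpermQ /=; case ruleE: (rule N _) => [b|];
  try exact: stop.
  by case: ifP; rewrite !mul0r.
case: ltnP => le1; first by rewrite !mul0r.
case: pickP => [y yN|_]; last by rewrite !mul0r.
have yb := valP y.
(* Eligibility puts a disagreement on [b]; it must be [y], the only explored node there. *)
have /andP[bN /existsP[z /andP[zQ zb]]] :
    eligible G N (disagreement N theta xi) b.
  by move: (rule_ok N (disagreement N theta xi)); rewrite ruleE.
have zN : inl z \in N by move: zQ; rewrite inE => /andP[].
have yQ : val y \in disagreement N theta xi.
  by rewrite -(unique_explored le1 yb yN zb zN).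
have xiy := tpermQ _ yQ.
rewrite !complete_restrict yN.
have prodE s : \prod_(a | inr a \notin N) factor_weight a s =
    factor_weight b s * \prod_(a | inr a \notin explore b N) factor_weight a s.
  rewrite (bigD1 b) //=; congr (_ * _); apply: eq_bigl => a.
  by rewrite inr_explore negb_or andbC.
have fwd f := switch_loop_branch rule c d theta xi n f le1 yb yN.
have bwd f := switch_loop_branch rule d c xi theta n f le1 yb yN.
rewrite (fwd id) (fwd (tperm c d)).
rewrite [disagreement N theta xi]disagreementC (bwd id) (bwd (tperm d c)).
rewrite !prodE (tpermC d c) !(@followsC _ b _ xi) //; last exact: tpermK.
rewrite [disagreement _ xi theta]disagreementC mulrDl [RHS]mulrDl.
(* Nodes explored in this round disagree only if they were flipped. *)
have tpermQ' f : follows f b (val y) theta xi ->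
    (forall e, f e = e \/ f e = tperm c d e) ->
    {in disagreement (explore b N) theta xi,
      forall v, xi v = tperm c d (theta v)}.
  move=> /followsP fol fE v; rewrite in_disagreement inl_explore.
  move=> /andP[vNb neq].
  have [vN|vN] := boolP (inl v \in N).
    by apply: tpermQ; rewrite inE vN neq.
  move: vNb; rewrite (negbTE vN) /= => vb.
  have vy : v != val y by apply: contraNneq vN => ->.
  case: (fE (theta v)) => e; move: (fol v vb vy); rewrite e // => xiE.
  by rewrite xiE eqxx in neq.
congr (_ + _).
(* Keep: on [b] the configurations differ only at [y], so both sides carry the minimum of the two
   weights. *)
- case: ifP => [fol|_]; last by rewrite !mulr0 !mul0r.
  have /IHn IH := tpermQ' _ fol (fun e => or_introl erefl).
  move/followsP: fol => fol.
  rewrite mulrACA [RHS]mulrACA IH; congr (_ * _).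
  rewrite mulrC [RHS]mulrC !flip_prob_keep ?xiy ?tpermK // 1?minC //.
  by move=> v vb /(fol v vb) ->.
(* Flip: on [b], including [y], one configuration is the swap of the other, so weights and flip
   probabilities agree. *)
case: ifP => [fol|_]; last by rewrite !mulr0 !mul0r.
have /IHn IH := tpermQ' _ fol (fun e => or_intror erefl).
have xiE : {in bd G b, forall v, xi v = tperm c d (theta v)}.
  move=> v vb; have [->//|] := eqVneq v (val y).
  exact: (followsP _ _ _ _ _ fol).
rewrite mulrACA [RHS]mulrACA IH; congr (_ * _).
by rewrite (flip_prob_flip y xiE) (factor_weight_tperm xiE).
Qed.

End Symmetry.

(** * Detailed balance for Switch *)

(** The loop starts in a state of the required form: [N] is [Lam] without factor nodes, so the
    product over unexplored factor nodes is the whole Gibbs weight. *)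
Lemma switch_balance rule (Lam : {set V})
    (eta kappa : {ffun {v : V | v \in Lam} -> A}) (theta xi : {ffun V -> A}) :
  (forall psi, Psi psi -> forall s, 0 <= psi s) -> symmetric_family Psi ->
  valid_rule G rule -> #|[set w | eta w != kappa w]| = 1%N ->
  (forall w : {v : V | v \in Lam}, theta (val w) = eta w) ->
  (forall w : {v : V | v \in Lam}, xi (val w) = kappa w) ->
  gibbs_weight G theta * switch G rule eta kappa theta (Some xi) =
  gibbs_weight G xi * switch G rule kappa eta xi (Some theta).
Proof.
move=> Psi_ge0 [Psi_tperm _] rule_ok /eqP/cards1P[x0 diffE] thetaE xiE.
have pickE : [pick w | kappa w != eta w] = [pick w | eta w != kappa w].
  by apply: eq_pick => w; rewrite eq_sym.
rewrite /switch pickE.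
case: pickP => [x neq|_]; last by rewrite !mulr0.
set N : {set V + F} := [set inl v | v in Lam].
have NE v : (inl v \in N) = (v \in Lam) by rewrite mem_imset // => ? ? [].
have NF a : inr a \notin N by apply/imsetP => -[].
have uniq_diff w : (eta w != kappa w) = (w == x).
  have : x \in [set w | eta w != kappa w] by rewrite inE.
  by rewrite diffE inE => /eqP ->; rewrite -[RHS]in_set1 -diffE inE.
have -> : [set val x] = disagreement N theta xi.
  apply/setP => v; rewrite in_disagreement NE in_set1.
  have [vL|vL] := boolP (v \in Lam); last first.
    by apply: contraNF vL => /eqP ->; exact: valP.
  rewrite (thetaE (exist _ v vL)) (xiE (exist _ v vL)) uniq_diff.
  by rewrite -val_eqE.
have restrE (s : {ffun {v : V | v \in Lam} -> A}) (sigma : {ffun V -> A}) :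
    (forall w : {v : V | v \in Lam}, sigma (val w) = s w) ->
    [ffun v => omap s (insub v)] = restrict N sigma.
  move=> sE; apply/ffunP => v; rewrite !ffunE NE.
  by case: insubP => [w vL vE|/negbTE ->//]; rewrite vL /= -sE vE.
rewrite (restrE _ _ thetaE) (restrE _ _ xiE) mulrC [RHS]mulrC.
have tpermQ : {in disagreement N theta xi,
    forall v, xi v = tperm (eta x) (kappa x) (theta v)}.
  move=> v; rewrite in_disagreement NE => /andP[vL].
  rewrite (thetaE (exist _ v vL)) (xiE (exist _ v vL)) uniq_diff.
  by move=> /eqP ->; rewrite tpermL.
have gibbsE s : gibbs_weight G s = \prod_(a | inr a \notin N) factor_weight a s.
  by apply: eq_bigl => a; rewrite NF.
rewrite !gibbsE.
exact: (switch_loop_balance Psi_ge0 (Psi_tperm _ _ neq) #|F| rule_ok tpermQ).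
Qed.

(** The spins on [Lam] are specified from the start, hence permanent. *)
Lemma switch_eq0 rule (Lam : {set V})
    (eta kappa : {ffun {v : V | v \in Lam} -> A}) (theta xi : {ffun V -> A}) w :
  xi (val w) != kappa w -> switch G rule eta kappa theta (Some xi) = 0.
Proof.
move=> neq; rewrite /switch; case: pickP => // x _.
apply: (@switch_loop_eq0 _ _ _ _ _ _ _ _ _ (val w)).
  by rewrite imset_f // (valP w).
by rewrite ffunE valK /= eq_sym.
Qed.

End Switch.

Theorem theorem4p2 (R : realFieldType) (A V F : finType) (k : nat)
    (Psi : weight R A k -> Prop)
    (hPsi : forall psi, Psi psi -> forall s, 0 <= psi s < 2)
    (G : factor_graph V F Psi)
    (hsym : symmetric_family Psi)
    (rule : selection_rule V F) (hrule : valid_rule G rule)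
    (Lam : {set V}) (eta kappa : {ffun {v : V | v \in Lam} -> A})
    (hdiff : #|[set w | eta w != kappa w]| = 1%N)
    (theta xi : {ffun V -> A}) :
  gibbs G theta * switch_prob G rule eta kappa theta xi =
  gibbs G xi * switch_prob G rule kappa eta xi theta.
Proof.
have Psi_ge0 psi : Psi psi -> forall s, 0 <= psi s.
  by move=> /hPsi H s; case/andP: (H s).
rewrite /gibbs mulrAC [RHS]mulrAC; congr (_ / _); rewrite /switch_prob.
(* With a wrong boundary condition one side is 0 by definition, the other because its target is
   unreachable. *)
case: forallP => [thetaE|/forallP/forallPn[w neq]]; last first.
  by case: ifP => _; rewrite ?(switch_eq0 _ _ _ _ neq) !mulr0.
case: forallP => [xiE|/forallP/forallPn[w neq]]; last first.
  by rewrite (switch_eq0 _ _ _ _ neq) !mulr0.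
by apply: switch_balance => // w; apply/eqP.
Qed.
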